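(* In a regular lattice, the $k$-th order area for every grid point $i\in B$ is equal: $$X_k(i)=X_{k+1}(i),\qquad \forall i\in B,\ \forall k\ge 1.$$
   Context: $B$ is the set of points of a regular lattice (regular grid); the case of interest is the 2-dimensional hexagonal grid, i.e. the lattice whose Voronoi cells are regular hexagons. For a point $i\in B$ and an integer $k\ge 1$, the $k$-th order area $X_k(i)$ is the (size of the) area on which $i$ is the $k$-th point if the points of $B$ are sorted by increasing distance, that is, the area of the set of locations for which $i$ is the $k$-th closest point of $B$. *)

(* Defs.v *)
From HB Require Import structures.
From mathcomp Require Import all_boot all_order all_algebra.
From mathcomp Require Import all_classical all_reals all_analysis.

Set Implicit Arguments.
Unset Strict Implicit.
Unset Printing Implicit Defensive.

Import Order.TTheory GRing.Theory Num.Theory.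
Import numFieldNormedType.Exports.

Local Open Scope classical_set_scope.
Local Open Scope ring_scope.

Section cons_measure.
Context (R : realType) (n : nat).
Variable mu : {sigma_finite_measure set (n.-tuple R) -> \bar R}.

Definition cons_pair (p : R * n.-tuple R) : n.+1.-tuple R :=
  [tuple of p.1 :: p.2].

Lemma measurable_cons_pair : measurable_fun [set: R * n.-tuple R] cons_pair.
Proof. exact: measurable_cons. Qed.

(* The product measure on R * R^n, transported to R^(n+1). *)
Definition cons_measure : set (n.+1.-tuple R) -> \bar R :=
  pushforward (@lebesgue_measure R \x mu)%E cons_pair.

Let cons_measure0 : cons_measure set0 = 0%E.
Proof. by rewrite /cons_measure /pushforward preimage_set0 measure0. Qed.

Let cons_measure_ge0 A : (0 <= cons_measure A)%E.
Proof. exact: (measure_ge0 (@lebesgue_measure R \x mu)%E). Qed.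

Let measurable_preimage_cons A : measurable A -> measurable (cons_pair @^-1` A).
Proof. by move=> mA; rewrite -[_ @^-1` _]setTI; exact: measurable_cons_pair. Qed.

Let cons_measure_sigma_additive : semi_sigma_additive cons_measure.
Proof.
move=> F mF tF mUF; rewrite /cons_measure /pushforward preimage_bigcup.
apply: (@measure_semi_sigma_additive _ _ _ (@lebesgue_measure R \x mu)%E).
- by move=> k; exact: measurable_preimage_cons.
- apply/trivIsetP => /= i j _ _ ij; rewrite -preimage_setI.
  by move/trivIsetP : tF => /(_ _ _ _ _ ij) ->//; rewrite preimage_set0.
- by rewrite -preimage_bigcup; exact: measurable_preimage_cons.
Qed.

HB.instance Definition _ := isMeasure.Build _ _ _ cons_measure
  cons_measure0 cons_measure_ge0 cons_measure_sigma_additive.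

Let cons_measure_sigma_finite : sigma_finite setT cons_measure.
Proof.
have /sigma_finiteP[F [TF ndF Foo]] := sigma_finiteT (@lebesgue_measure R).
have /sigma_finiteP[G [TG ndG Goo]] := sigma_finiteT mu.
pose behead_t (t : n.+1.-tuple R) : n.-tuple R := [tuple of behead t].
exists (fun k => (@tnth _ R ^~ ord0) @^-1` F k `&` behead_t @^-1` G k).
  apply/seteqP; split => // t _.
  have [k _ Fk] : (\bigcup_k F k) (tnth t ord0) by rewrite -TF.
  have [l _ Gl] : (\bigcup_k G k) (behead_t t) by rewrite -TG.
  exists (maxn k l) => //; split => /=.
    by move: Fk; exact/subsetPset/ndF/leq_maxl.
  by move: Gl; exact/subsetPset/ndG/leq_maxr.
move=> k; have [mF Fk] := Foo k; have [mG Gk] := Goo k; split.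
  apply: measurableI; rewrite -[_ @^-1` _]setTI.
    exact: measurable_tnth.
  exact: measurable_behead.
rewrite /cons_measure /pushforward (_ : _ @^-1` _ = F k `*` G k).
  by rewrite product_measure1E// lte_mul_pinfty// ge0_fin_numE.
have consK x (t : n.-tuple R) : behead_t (cons_pair (x, t)) = t by exact: val_inj.
by apply/seteqP; split => -[x t]; rewrite /preimage /= consK.
Qed.

HB.instance Definition _ := @Measure_isSigmaFinite.Build _ _ _
  cons_measure cons_measure_sigma_finite.

End cons_measure.

(* n-dimensional Lebesgue measure (the area when n = 2), as the n-fold product
   of lebesgue_measure; R^0 is a point of measure 1. *)
Fixpoint lebesgue_tuple (R : realType) (n : nat) :
    {sigma_finite_measure set (n.-tuple R) -> \bar R} :=
  match n with
  | 0 => \d_ [tuple]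
  | m.+1 => cons_measure (lebesgue_tuple R m)
  end.

Definition volume (R : realType) (n : nat) (A : set 'rV[R]_n) : \bar R :=
  lebesgue_tuple R n [set t | A (\row_(j < n) tnth t j)].

(* The norm that the library puts on 'rV[R]_n is the sup norm. *)
Definition edist (R : realType) (n : nat) (x y : 'rV[R]_n) : R :=
  Num.sqrt (\sum_(j < n) (x ord0 j - y ord0 j) ^+ 2).

(* The points o + z_0 v_0 + ... + z_(n-1) v_(n-1), with z_j integers, where
   v_j is the j-th row of V and v_0, ..., v_(n-1) is a basis of R^n. *)
Definition regular_lattice (R : realType) (n : nat) (B : set 'rV[R]_n) : Prop :=
  exists (o : 'rV[R]_n) (V : 'M[R]_n), V \in unitmx /\
    B = [set o + map_mx intr z *m V | z in [set: 'rV[int]_n]].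

(* s 0, s 1, ... lists every point of B exactly once; the order of points that
   are equidistant from x is left free. *)
Definition sorts_by_distance (R : realType) (n : nat) (B : set 'rV[R]_n)
    (x : 'rV[R]_n) (s : nat -> 'rV[R]_n) : Prop :=
  set_bij [set: nat] B s /\
  {homo s : a b / (a <= b)%N >-> edist x a <= edist x b}.

(* Ranks start at 1 while s starts at index 0. Where several points of B are
   equidistant from x, each of them has every rank that some sorting gives it:
   regions of consecutive orders may overlap in their common boundary. *)
Definition kth_region (R : realType) (n : nat) (B : set 'rV[R]_n) (k : nat)
    (i : 'rV[R]_n) : set 'rV[R]_n :=
  [set x | exists s, sorts_by_distance B x s /\ s k.-1 = i].

Definition kth_area (R : realType) (n : nat) (B : set 'rV[R]_n) (k : nat)
    (i : 'rV[R]_n) : \bar R :=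
  volume (kth_region B k i).

(* Main.v *)
Require Import Defs.
From mathcomp Require Import all_boot all_order all_algebra.
From mathcomp Require Import all_classical all_reals all_analysis.
From mathcomp Require Import measurable_realfun ring zify.

Set Implicit Arguments.
Unset Strict Implicit.
Unset Printing Implicit Defensive.

Import Order.TTheory GRing.Theory Num.Theory.
Import numFieldNormedType.Exports.

Local Open Scope classical_set_scope.
Local Open Scope ring_scope.


(** All the areas X_k(i) are equal because, for each fixed k, the regions
    [kth_region B k j], j in B, form a tiling of space by translates of one
    another, so that each of them is a fundamental domain of the lattice, and
    two fundamental domains have the same volume.

    In detail, a point x that is equidistant from no two lattice points has
    exactly one k-th closest lattice point ([kth_region_cover],
    [kth_region_disjoint]); the remaining points lie on countably many
    bisector hyperplanes and form a null set ([equidistant_negligible]).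
    Translating by a difference a - b of lattice points permutes the regions of
    order k ([kth_region_shift]). Hence, with D_j the region of j of order k'
    and A_j its region of order k,
      vol A_i = sum_j vol (A_i n D_j) = sum_j vol (A_(i - j + i) n D_i) = vol D_i,
    where the first equality cuts A_i along the tiling D, the second one
    translates the j-th piece by i - j, and the last one cuts D_i along the
    tiling A, j |-> i - j + i being a permutation of B. This is
    [kth_area_const]; it only uses that B is infinite, has finitely many points
    in each ball, and is closed under a - b + c.

    Measurability of the regions comes from counting: i is a k-th closest point
    to x exactly when at least k points of B are at distance at most |x - i|
    and fewer than k are at distance less than |x - i|
    ([kth_region_counts]). The facts needed about the n-fold product of Lebesgue
    measure, its invariance under translations and the nullity of hyperplanes,
    are proved by induction on the dimension. *)

(* The name edist also denotes the extended distance of a pseudometric space. *)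
Local Notation edist := Defs.edist.

(** * Enumerations in nondecreasing order of a function *)

Section sorting.
Context {R : realType} {T : choiceType}.
Variables (f : T -> R) (B : set T).

Definition sorts (s : nat -> T) : Prop :=
  set_bij [set: nat] B s /\ {homo s : a b / (a <= b)%N >-> f a <= f b}.

Definition finite_sublevels : Prop :=
  forall c : R, finite_set (B `&` [set b | f b <= c]).

Lemma seq_argmin (r : seq T) b0 : b0 \in r ->
  exists2 b, b \in r & forall b', b' \in r -> f b <= f b'.
Proof.
elim: r b0 => [//|a q IH] _ _; case: q IH => [_|c q /(_ c (mem_head _ _))].
  exists a; first exact: mem_head.
  by move=> b'; rewrite inE => /eqP ->.
move=> [b bq bmin]; have [ab|/ltW ba] := leP (f a) (f b).
  exists a; first exact: mem_head.
  move=> b'; rewrite inE => /orP[/eqP ->//|b'q].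
  exact: (le_trans ab (bmin _ b'q)).
exists b; first by rewrite inE bq orbT.
by move=> b'; rewrite inE => /orP[/eqP ->//|/bmin].
Qed.

Lemma exists_argmin (l : seq T) : infinite_set B -> finite_sublevels ->
  exists b, [/\ B b, b \notin l & forall b', B b' -> b' \notin l -> f b <= f b'].
Proof.
move=> Binf ffin.
have [b0 [Bb0 b0l]] : (B `\` [set` l]) !=set0.
  by apply: infinite_setN0; apply: infinite_setD => //; exact: finite_seq.
have /finite_seqP[r rE] : finite_set (B `&` [set b | f b <= f b0] `\` [set` l]).
  by apply: finite_setD; exact: ffin.
have inr b' : B b' -> f b' <= f b0 -> b' \notin l -> b' \in r.
  move=> Bb' b'b0 b'l; suff : [set` r] b' by [].
  by rewrite -rE; split=> //; exact/negP.
have [|b br bmin] := @seq_argmin r b0; first exact/inr/negP.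
have [[Bb bb0] /negP bl] : (B `&` [set b | f b <= f b0] `\` [set` l]) b.
  by rewrite rE.
exists b; split=> // b' Bb' b'l; have [b'b0|/ltW b0b'] := leP (f b') (f b0).
  exact/bmin/inr.
exact: le_trans b0b'.
Qed.

(** Greedy selection: the next point is one that minimizes f among the points
    not yet listed. No point b is left out, since otherwise the infinitely many
    listed points would all lie in the finite sublevel set of f b. *)
Lemma exists_sorts : infinite_set B -> finite_sublevels -> exists s, sorts s.
Proof.
move=> Binf ffin.
have [next nextP] := choice (fun l => @exists_argmin l Binf ffin).
pose L := fix L k := if k is k'.+1 then rcons (L k') (next (L k')) else [::].
pose s k := next (L k).
have LE k : L k = map s (iota 0 k).
  by elim: k => // k IH; rewrite -addn1 iotaD map_cat -IH add0n addn1 cats1.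
have sB k : B (s k) by case: (nextP (L k)).
have snew a b : (a < b)%N -> s a != s b.
  move=> ab; have [_ + _] := nextP (L b); apply: contraNneq => sab.
  by rewrite -/(s b) -sab LE map_f// mem_iota.
have sinj : injective s.
  move=> a b /eqP; apply: contraTeq; rewrite neq_ltn => /orP[|] /snew //.
  by rewrite eq_sym.
have smin b k : B b -> (forall a, (a < k)%N -> s a != b) -> f (s k) <= f b.
  move=> Bb bs; have [_ _] := nextP (L k); apply => //.
  rewrite LE; apply/negP => /mapP[a]; rewrite mem_iota add0n => /= ak.
  by apply/eqP; rewrite eq_sym bs.
exists s; split; last first.
  by move=> a b ab; apply: smin => // c ca; exact/snew/(leq_trans ca).
split=> [k _||b Bb]; [exact: sB|exact: in2W|apply: contrapT => bNs].
have : finite_set (range s).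
  apply: (sub_finite_set _ (ffin (f b))) => _ [k _ <-]; split=> //=.
  by apply: smin => // a _; apply/eqP => sab; apply: bNs; exists a.
by rewrite (eq_finite_set (inj_card_eq (in2W sinj))); exact: infinite_nat.
Qed.



(** Expresses the k-th smallest value of f without mentioning s. It is used with
    the initial segments d <= c and d < c. *)
Lemma sorts_nth_down (P : R -> Prop) s k : sorts s ->
  (forall a b, a <= b -> P b -> P a) ->
  P (f (s k)) <-> exists l : seq T,
    [/\ uniq l, size l = k.+1 & forall b, b \in l -> B b /\ P (f b)].
Proof.
move=> [[sB sinj ssur] smon] Pdown; split=> [Pk|[l [lu ls lP]]].
  exists (map s (iota 0 k.+1)); split; last 2 first.
  - by rewrite size_map size_iota.
  - move=> _ /mapP[a + ->]; rewrite mem_iota add0n ltnS => /= ak.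
    by split; [apply: sB|exact/(Pdown _ _ _ Pk)/smon].
  - rewrite map_inj_uniq ?iota_uniq// => a b; apply: sinj; exact: in_setT.
apply: contrapT => NPk; suff : (k.+1 <= k)%N by rewrite ltnn.
rewrite -ls -[leqRHS](size_iota 0) -(size_map s); apply: uniq_leq_size => // b.
move=> /lP[/ssur[a _ <-] Pa]; apply: map_f; rewrite mem_iota add0n /=.
rewrite ltnNge; apply/negP => ka; apply: NPk.
exact: (Pdown _ _ (smon _ _ ka)).
Qed.

Lemma sorts_nth_uniq s s' k : sorts s -> sorts s' -> f (s k) = f (s' k).
Proof.
have le_s t t' : sorts t -> sorts t' -> f (t k) <= f (t' k).
  move=> st st'.
  have down a b : a <= b -> b <= f (t' k) -> a <= f (t' k) by exact: le_trans.
  by apply/(sorts_nth_down k st down)/(sorts_nth_down k st' down).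
by move=> ss ss'; apply/le_anti; rewrite !le_s.
Qed.

(** Ties can be broken at will: swapping the positions of i and of s k, which
    have the same value, keeps the list sorted. *)
Lemma sorts_exchange s k i : sorts s -> B i -> f (s k) = f i ->
  exists s', sorts s' /\ s' k = i.
Proof.
move=> [[sB sinj ssur] smon] Bi ki; have [p _ spi] := ssur _ Bi.
pose swap a := if a == k then p else if a == p then k else a.
have swapK : involutive swap.
  move=> a; rewrite /swap; have [->|ak] := eqVneq a k.
    by rewrite eqxx; case: eqVneq.
  by have [->|/negPf ->] := eqVneq a p; rewrite ?eqxx// (negPf ak).
have fswap a : f (s (swap a)) = f (s a).
  rewrite /swap; have [->|_] := eqVneq a k; first by rewrite spi ki.
  by have [->|//] := eqVneq a p; rewrite spi ki.
exists (s \o swap); split; last by rewrite /= /swap eqxx.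
split; last by move=> a b ab /=; rewrite !fswap; exact: smon.
split=> [a _|a b _ _ /sinj /(can_inj swapK)|b /ssur[a _ <-]].
- exact: sB.
- by apply; exact: in_setT.
- by exists (swap a); rewrite //= swapK.
Qed.

End sorting.

(** * Lebesgue measure on tuples *)

Section lebesgue_tuple_theory.
Context {R : realType}.

Definition shift_tuple n (v : 'I_n -> R) (t : n.-tuple R) : n.-tuple R :=
  [tuple tnth t j + v j | j < n].

Lemma measurable_shift_tuple n (v : 'I_n -> R) :
  measurable_fun [set: n.-tuple R] (shift_tuple v).
Proof.
apply/measurable_fun_tnthP => j.
rewrite (_ : _ \o _ = fun t => tnth t j + v j); last first.
  by apply/funext => t /=; rewrite tnth_mktuple.
by apply: measurable_funD; [exact: measurable_tnth|exact: measurable_cst].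
Qed.

Lemma lebesgue_measure_shift (a : R) (A : set R) : measurable A ->
  lebesgue_measure ((fun x => x + a) @^-1` A) = lebesgue_measure A.
Proof.
pose sh : measurableTypeR R -> measurableTypeR R := fun x => x + a.
have msh : measurable_fun setT sh.
  by apply: measurable_funD; [exact: measurable_id|exact: measurable_cst].
move=> mA; apply/esym.
apply: (lebesgue_measure_unique (mu := pushforward lebesgue_measure sh)) => //.
move=> _ [[b c]] _ <- /=.
have shE : sh @^-1` `]b, c] = `]b - a, c - a]%classic.
  by apply/seteqP; split => x; rewrite /= !in_itv /= ltrBlDr lerBrDr.
transitivity (lebesgue_measure (`]b - a, c - a]%classic : set R)).
  by rewrite !lebesgue_measure_itv/= !lte_fin ltrD2r -!EFinB opprB addrA subrK.
by rewrite -shE.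
Qed.

(** In coordinates (x, t) of R * R^n the translation acts on each factor
    separately, so that translating the product measure gives a measure with the
    same values on rectangles; such a measure is unique. *)
Lemma lebesgue_tuple_shift n (v : 'I_n -> R) (A : set (n.-tuple R)) :
  measurable A -> lebesgue_tuple R n (shift_tuple v @^-1` A) = lebesgue_tuple R n A.
Proof.
elim: n v A => [|n IHn] v A mA.
  congr (lebesgue_tuple R 0 _); apply/funext => t.
  by congr A; rewrite [LHS]tuple0 [RHS]tuple0.
pose mu := lebesgue_tuple R n.
pose v' j := v (lift ord0 j).
pose sh (p : measurableTypeR R * n.-tuple R) : measurableTypeR R * n.-tuple R :=
  (p.1 + v ord0, shift_tuple v' p.2).
have msh : measurable_fun setT sh.
  apply: measurable_fun_pair.
    by apply: measurable_funD => //; exact: measurable_cst.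
  by apply: measurableT_comp => //; exact: measurable_shift_tuple.
have shE p : shift_tuple v (cons_pair p) = cons_pair (sh p).
  case: p => x t; apply/eq_from_tnth => j; rewrite tnth_mktuple.
  have [->|] := eqVneq j ord0; first by rewrite !tnth0.
  rewrite eq_sym => /unlift_some[k -> _].
  by rewrite !tnthS tnth_mktuple.
rewrite /= /cons_measure /pushforward.
rewrite (_ : _ @^-1` _ = sh @^-1` (@cons_pair R n @^-1` A)); last first.
  by apply/funext => p; rewrite /preimage /= shE.
apply/esym.
apply: (product_measure_unique
  (m' := pushforward (@lebesgue_measure R \x mu)%E sh)); last first.
  by rewrite -[_ @^-1` _]setTI; exact: measurable_cons_pair.
move=> C D mC mD.
transitivity ((@lebesgue_measure R \x mu)%E
  (((fun x => x + v ord0) @^-1` C) `*` (shift_tuple v' @^-1` D))) => //.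
rewrite product_measure1E.
- by congr (_ * _)%E; [exact: lebesgue_measure_shift|exact: IHn].
- rewrite -[_ @^-1` _]setTI; apply: measurable_funD => //; exact: measurable_cst.
- by rewrite -[_ @^-1` _]setTI; exact: measurable_shift_tuple.
Qed.

Lemma measurable_linear_form n (c : 'I_n -> R) :
  measurable_fun [set: n.-tuple R] (fun t => \sum_(j < n) c j * tnth t j).
Proof.
apply: measurable_sum => j; apply: measurable_funM; first exact: measurable_cst.
exact: measurable_tnth.
Qed.

(** If the form depends on a coordinate other than the first, each section at a
    fixed first coordinate is a hyperplane of R^n, null by induction. Otherwise
    the hyperplane is a product of a single point with R^n. *)
Lemma lebesgue_tuple_hyperplane n (c : 'I_n -> R) (b : R) : (exists j, c j != 0) ->
  lebesgue_tuple R n [set t | \sum_(j < n) c j * tnth t j = b] = 0%E.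
Proof.
elim: n c b => [|n IHn] c b [j cj]; first by case: j cj.
pose mu := lebesgue_tuple R n.
pose c' j := c (lift ord0 j).
rewrite /= /cons_measure /pushforward.
pose H := [set p : measurableTypeR R * n.-tuple R |
  c ord0 * p.1 + \sum_(j < n) c' j * tnth p.2 j = b].
rewrite (_ : _ @^-1` _ = H); last first.
  apply/funext => -[x t]; rewrite /preimage /= big_ord_recl tnth0.
  by under eq_bigr do rewrite tnthS.
have [[k ck]|/forallNP c'0] := pselect (exists k, c' k != 0).
  apply: integral0_eq => x _ /=.
  rewrite (_ : xsection H x = [set t | \sum_(j < n) c' j * tnth t j = b - c ord0 * x]).
    by apply: IHn; exists k.
  apply/seteqP; split => t; rewrite /xsection /H /= inE /=.
    by move=> <-; rewrite addrC addKr.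
  by move=> ->; rewrite addrC subrK.
have c0 : c ord0 != 0.
  have [j0|] := eqVneq j ord0; first by rewrite -j0.
  by rewrite eq_sym => /unlift_some[k jk _]; case: (c'0 k); rewrite /c' -jk.
rewrite (_ : H = [set (c ord0)^-1 * b] `*` setT).
  rewrite product_measure1E// -[RHS](mul0e (mu setT)).
  by congr (_ * _)%E; exact: lebesgue_measure_set1.
have c'E t : \sum_(j < n) c' j * tnth t j = 0.
  rewrite big1// => k _; move/negP: (c'0 k).
  by rewrite negbK => /eqP ->; rewrite mul0r.
apply/seteqP; split => -[x t]; rewrite /H /= c'E addr0.
  by move=> <-; rewrite mulKf.
by move=> [-> _]; rewrite mulVKf.
Qed.

End lebesgue_tuple_theory.

(** * Regions of a given order *)

(** The sets D m need to cover the space and to be disjoint only up to a null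
    set: the regions of a lattice share their boundaries. *)
Lemma measure_tiling d (T : measurableType d) (R : realType)
    (mu : {measure set T -> \bar R}) (N A : set T) (D : nat -> set T) :
  mu.-negligible N -> measurable A -> (forall m, measurable (D m)) ->
  (forall x, ~ N x -> exists m, D m x) ->
  (forall x a b, ~ N x -> D a x -> D b x -> a = b) ->
  mu A = (\sum_(m <oo) mu (A `&` D m))%E.
Proof.
move=> [N' [mN' N'0 NN']] mA mD Dcover Ddisj.
have off_null X : measurable X -> mu X = mu (X `\` N').
  move=> mX; rewrite (measureDI mu mX mN') [X in (_ + X)%E](_ : _ = 0%E) ?adde0//.
  by apply: (subset_measure0 _ mN' _ N'0); [exact: measurableI|exact: subIsetr].
rewrite off_null// (_ : A `\` N' = \bigcup_m ((A `&` D m) `\` N')); last first.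
  apply/seteqP; split=> [x [Ax N'x]|x [m _ [[Ax _] N'x]]//].
  by have [|m Dx] := Dcover x; [move/NN'|exists m].
rewrite measure_bigcup.
- rewrite (@eq_eseriesl _ _ xpredT); last by move=> m; rewrite in_setT.
  apply: eq_eseriesr => m _.
  by rewrite [RHS]off_null//; exact: measurableI.
- by move=> m _; apply: measurableD => //; exact: measurableI.
- move=> a b _ _ [x [[[_ Da] N'x] [[_ Db] _]]].
  by apply: (Ddisj x) => // /NN'.
Qed.

Section regions.
Context {R : realType} {n : nat}.
Implicit Types (x i p q v : 'rV[R]_n) (A : set 'rV[R]_n).

Let row (t : n.-tuple R) : 'rV[R]_n := \row_(j < n) tnth t j.

Lemma row_shift v t : row (shift_tuple (v ord0) t) = row t + v.
Proof. by apply/rowP => j; rewrite !mxE tnth_mktuple. Qed.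

Lemma edist_shift x p v : edist (x + v) (p + v) = edist x p.
Proof.
congr Num.sqrt; apply: eq_bigr => j _; rewrite !mxE.
by rewrite opprD addrACA subrr addr0.
Qed.

Lemma measurable_edist p : measurable_fun setT (fun t => edist (row t) p).
Proof.
apply: measurableT_comp.
  by apply: continuous_measurable_fun; exact: sqrt_continuous.
apply: measurable_sum => j; apply: measurable_funX; apply: measurable_funB => //.
rewrite (_ : (fun _ => _) = (fun t : n.-tuple R => tnth t j)).
  exact: measurable_tnth.
by apply/funext => t; rewrite mxE.
Qed.

(** The squares of the coordinates of x cancel in |x - p|^2 - |x - q|^2, which
    leaves an affine form in x with linear part 2 (q - p). *)
Lemma bisector_negligible p q : p != q ->
  (lebesgue_tuple R n).-negligible [set t | edist (row t) p = edist (row t) q].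
Proof.
move=> pq.
pose c j := 2 * (q ord0 j - p ord0 j).
pose b := \sum_(j < n) (q ord0 j ^+ 2 - p ord0 j ^+ 2).
exists [set t | \sum_(j < n) c j * tnth t j = b]; split.
- rewrite -[X in measurable X]setTI.
  have := measurable_linear_form c measurableT (measurable_set1 b); exact.
- apply: lebesgue_tuple_hyperplane; apply: contrapT => /forallNP c0.
  move/eqP: pq; apply; apply/rowP => j; apply/esym/eqP; rewrite -subr_eq0.
  move/negP: (c0 j); rewrite negbK mulf_eq0 => /orP[|//].
  by rewrite pnatr_eq0.
- move=> t /= /(congr1 (fun d => d ^+ 2)); rewrite /edist !sqr_sqrtr; last 2 first.
  + by apply: sumr_ge0 => j _; exact: sqr_ge0.
  + by apply: sumr_ge0 => j _; exact: sqr_ge0.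
  move=> /eqP; rewrite -subr_eq0 -sumrB => /eqP d0.
  apply: subr0_eq; rewrite -sumrB -[RHS]d0; apply: eq_bigr => j _.
  rewrite /c !mxE; ring.
Qed.

Variable B : set 'rV[R]_n.
Hypothesis Binf : infinite_set B.
Hypothesis Bfin : forall x, finite_sublevels (edist x) B.
Hypothesis Btrans : forall a b c, B a -> B b -> B c -> B (a - b + c).

Let Bsort x : exists s, sorts_by_distance B x s.
Proof. exact: exists_sorts. Qed.

Lemma kth_regionP k i x : B i -> kth_region B k i x <->
  exists2 s, sorts_by_distance B x s & edist x (s k.-1) = edist x i.
Proof.
move=> Bi; split=> [[s [xs <-]]|[s xs si]]; first by exists s.
by have [s' [xs' s'i]] := sorts_exchange xs Bi si; exists s'.
Qed.

(** The length is k.-1.+1 rather than k because the regions of orders 0 and 1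
    are the same set. *)
Definition has_points (P : R -> Prop) x k := exists l : seq 'rV[R]_n,
  [/\ uniq l, size l = k.-1.+1 & forall b, b \in l -> B b /\ P (edist x b)].

Lemma kth_region_counts k i x : B i -> kth_region B k i x <->
  has_points (fun d => d <= edist x i) x k /\
  ~ has_points (fun d => d < edist x i) x k.
Proof.
move=> Bi; have [s xs] := Bsort x.
have le_count := @sorts_nth_down _ _ (edist x) B
  (fun d => d <= edist x i) s k.-1 xs (fun a b => @le_trans _ _ b a _).
have lt_count := @sorts_nth_down _ _ (edist x) B
  (fun d => d < edist x i) s k.-1 xs (fun a b => @le_lt_trans _ _ b a _).
rewrite kth_regionP//; split=> [[s' xs' s'i]|[/le_count si /lt_count Nsi]].
  have si := sorts_nth_uniq k.-1 xs xs'; rewrite s'i in si.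
  by split; [apply/le_count; rewrite si|move/lt_count; rewrite si ltxx].
by exists s => //; apply/le_anti; rewrite si leNgt; exact/negP.
Qed.

(** The points of B are enumerated by a sequence e, so that the witnessing lists
    range over the countable type of lists of indices, and each list gives
    finitely many comparisons of distances. *)
Lemma measurable_has_points (r : rel R) k i :
  (forall p, measurable [set t | r (edist (row t) p) (edist (row t) i)]) ->
  measurable [set t | has_points (r ^~ (edist (row t) i)) (row t) k].
Proof.
move=> mr; have [e [[eB einj esur] _]] := Bsort 0.
pose F (m : seq nat) : set (n.-tuple R) :=
  if uniq m && (size m == k.-1.+1) then
    \bigcap_(a in [set` m]) [set t | r (edist (row t) (e a)) (edist (row t) i)]
  else set0.
rewrite (_ : [set t | _] = \bigcup_m F m).
  apply: countable_bigcupT_measurable => [|m]; first exact: countableP.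
  rewrite /F; case: ifP => _ //.
  by apply: bigcap_measurableType => a _; exact: mr.
apply/seteqP; split=> [t [l [lu ls lP]]|t [m _]].
  have [m lE] : exists m, l = map e m.
    elim: l lP {lu ls} => [|b l IH] lP; first by exists [::].
    have [|m ->] := IH; first by move=> c cl; apply: lP; rewrite inE cl orbT.
    have [/esur[a _ <-] _] := lP b (mem_head _ _).
    by exists (a :: m).
  exists m => //; rewrite /F -(size_map e) -lE ls eqxx.
  rewrite (map_uniq (f := e)) -?lE//= => a am.
  by apply: (lP _ _).2; rewrite lE map_f.
rewrite /F; case: ifP => // /andP[mu /eqP ms] mP.
exists (map e m); split.
- by rewrite map_inj_uniq// => a b; apply: einj; exact: in_setT.
- by rewrite size_map.
- by move=> _ /mapP[a am ->]; split; [exact: eB|exact: mP].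
Qed.

Lemma measurable_kth_region k i : B i ->
  measurable [set t | kth_region B k i (row t)].
Proof.
move=> Bi; rewrite (_ : [set t | _] =
    [set t | has_points (fun d => d <= edist (row t) i) (row t) k] `\`
    [set t | has_points (fun d => d < edist (row t) i) (row t) k]); last first.
  by apply/funext => t; apply/propext; exact: kth_region_counts.
have mle p q : measurable [set t | edist (row t) p <= edist (row t) q].
  rewrite -[X in measurable X]setTI.
  by apply: measurable_fun_le => //; exact: measurable_edist.
apply: measurableD; apply: measurable_has_points => // p.
rewrite (_ : [set t | _] = ~` [set t | edist (row t) i <= edist (row t) p]).
  exact: measurableC.
by apply/funext => t; rewrite /setC /= ltNge; apply/propext; split=> /negP.
Qed.

Definition equidistant : set (n.-tuple R) := [set t | exists p q,
  [/\ B p, B q, p != q & edist (row t) p = edist (row t) q]].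

Lemma equidistant_negligible : (lebesgue_tuple R n).-negligible equidistant.
Proof.
have [e [[eB einj esur] _]] := Bsort 0.
(* Only countably many bisectors occur, since e enumerates B. *)
apply: (@negligibleS _ _ _ _ (\bigcup_a \bigcup_b
    [set t | e a != e b /\ edist (row t) (e a) = edist (row t) (e b)])).
  by move=> t [_ [_ [/esur[a _ <-] /esur[b _ <-] ab tab]]]; exists a => //; exists b.
apply: negligible_bigcup => a; apply: negligible_bigcup => b.
have [eab|eab] := eqVneq (e a) (e b).
  by apply: (negligibleS _ (negligible_set0 _)) => t [].
by apply: (negligibleS _ (bisector_negligible eab)) => t [].
Qed.

Lemma kth_region_cover k x : exists2 i, B i & kth_region B k i x.
Proof.
have [s xs] := Bsort x; exists (s k.-1); last by exists s.
by case: xs => -[sB _ _] _; exact: sB.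
Qed.

Lemma kth_region_disjoint k i j t : ~ equidistant t -> B i -> B j ->
  kth_region B k i (row t) -> kth_region B k j (row t) -> i = j.
Proof.
move=> Nt Bi Bj [s [ts si]] [s' [ts' sj]]; apply/eqP/negP => /negP ij; apply: Nt.
exists i, j; split => //.
by rewrite -si -sj; exact: (sorts_nth_uniq k.-1 ts ts').
Qed.

(** Adding a - b to a sorted list of B for x gives one for x + (a - b). *)
Lemma kth_region_shift a b k i x : B a -> B b ->
  kth_region B k i x -> kth_region B k (a - b + i) (x + (a - b)).
Proof.
move=> Ba Bb [s [[[sB sinj ssur] smon] <-]].
exists (fun m => a - b + s m); split => //; split; last first.
  by move=> m m' mm'; rewrite ![a - b + _]addrC !edist_shift; exact: smon.
split=> [m _|m m' mT m'T /addrI|c Bc]; first by apply: Btrans => //; exact: sB.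
  exact: sinj.
have [m _ sm] := ssur _ (Btrans Bb Ba Bc).
by exists m => //; rewrite sm addrA -opprB addNr add0r.
Qed.

(** The double counting of the pieces cut out of the region of order k by the
    regions of order k'. Indexing B by a sequence e, and again by its reflection
    e', allows both countable sums to be compared term by term. *)
Lemma kth_area_const k k' i : B i -> kth_area B k i = kth_area B k' i.
Proof.
move=> Bi; have [e [[eB einj esur] _]] := Bsort 0.
pose mu := lebesgue_tuple R n.
pose U k j := [set t | kth_region B k j (row t)].
have mU h j : B j -> measurable (U h j) by exact: measurable_kth_region.
pose e' m := i - e m + i.
have e'B m : B (e' m) by apply: Btrans => //; exact: eB.
have pointK p : i - (i - p + i) + i = p.
  by rewrite opprD opprB addrA [i + (p - i)]addrC subrK subrK.
have area_sum h h' c : (forall m, B (c m)) -> injective c ->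
    (forall j, B j -> exists m, c m = j) ->
    mu (U h i) = (\sum_(m <oo) mu (U h i `&` U h' (c m)))%E.
  move=> cB cinj csur; apply: measure_tiling equidistant_negligible _ _ _ _.
  - exact: mU.
  - by move=> m; exact: mU.
  - move=> t _; have [_ /csur[m <-] Ut] := kth_region_cover h' (row t).
    by exists m.
  - by move=> t a b Nt /(kth_region_disjoint Nt (cB a) (cB b)) /[apply] /cinj.
rewrite /kth_area /volume.
transitivity (\sum_(m <oo) mu (U k i `&` U k' (e m)))%E.
  apply: area_sum => [m|a b|j /esur[m _ <-]]; [exact: eB| |by exists m].
  by apply: einj; exact: in_setT.
transitivity (\sum_(m <oo) mu (U k' i `&` U k (e' m)))%E; last first.
  apply/esym/area_sum => [//|a b /addIr /addrI /oppr_inj|j Bj].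
    by apply: einj; exact: in_setT.
  have [m _ em] := esur _ (Btrans Bi Bj Bi).
  by exists m; rewrite /e' em pointK.
apply: eq_eseriesr => m _.
(* The translation by i - e m takes e m to i and i to e' m. *)
rewrite -[RHS](lebesgue_tuple_shift ((i - e m) ord0)); last first.
  by apply: measurableI; apply: mU.
congr (mu _); apply/funext => t; rewrite /preimage /U /= !row_shift.
apply/propext; have iem : e m - i = - (i - e m) by rewrite opprB.
split=> [[ti te]|[ti te]].
  split; last exact: (kth_region_shift Bi (eB m I) ti).
  by have := kth_region_shift Bi (eB m I) te; rewrite subrK.
have ti' := kth_region_shift (eB m I) Bi ti.
have te' := kth_region_shift (eB m I) Bi te.
move: ti' te'; rewrite subrK iem addrK /e' addKr => ti' te'.
by split.
Qed.

End regions.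

(** * Lattices *)

Section lattices.
Context {R : realType} {n : nat}.
Implicit Types (x b : 'rV[R]_n).

Lemma coord_le_edist x b j : `|x ord0 j - b ord0 j| <= edist x b.
Proof.
rewrite -sqrtr_sqr; apply: ler_wsqrtr; rewrite (bigD1 j)//= lerDl.
by apply: sumr_ge0 => l _; exact: sqr_ge0.
Qed.

Variables (o : 'rV[R]_n) (V : 'M[R]_n).
Hypothesis Vunit : V \in unitmx.

Let point (z : 'rV[int]_n) : 'rV[R]_n := o + map_mx intr z *m V.

Lemma point_inj : injective point.
Proof.
move=> z z' /addrI /(congr1 (mulmx^~ (invmx V))); rewrite !mulmxK// => zz'.
by apply/rowP => j; have /rowP/(_ j) := zz'; rewrite !mxE => /intr_inj.
Qed.

Lemma lattice_infinite : (0 < n)%N -> infinite_set (range point).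
Proof.
move=> n0 fin; apply: infinite_nat.
pose h (k : nat) := point (const_mx k%:Z).
have hinj : injective h.
  by move=> a b /point_inj/rowP/(_ (Ordinal n0)); rewrite !mxE => -[].
rewrite -(eq_finite_set (inj_card_eq (in2W hinj))).
by apply: sub_finite_set fin => _ [k _ <-]; exists (const_mx k%:Z).
Qed.

(** The integer coordinates of a lattice point b are those of b - o in the basis
    V, hence bounded linearly, through the entries of the inverse of V, by the
    coordinates of b - o. A ball thus meets the image of a finite box only. *)
Lemma lattice_locally_finite x : finite_sublevels (edist x) (range point).
Proof.
move=> r.
pose M (l : 'I_n) := \sum_j (`|x ord0 j - o ord0 j| + r) * `|invmx V j l|.
pose N := Num.bound (\sum_l `|M l|).
pose box (w : 'rV['I_(N + N).+1]_n) : 'rV[int]_n := \row_l ((w ord0 l)%:Z - N%:Z).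
apply: (@sub_finite_set _ _ ((point \o box) @` setT)); last first.
  by apply: finite_image; exact: finite_finset.
move=> _ [[z _ <-]] /= zr.
have zM l : `|z ord0 l|%:~R <= M l :> R.
  have -> : (`|z ord0 l|%:~R : R) = `|((point z - o) *m invmx V) ord0 l|.
    by rewrite /point addrC addKr mulmxK// mxE intr_norm.
  rewrite mxE; apply: le_trans (ler_norm_sum _ _ _) _; apply: ler_sum => j _.
  rewrite normrM; apply: ler_wpM2r => //.
  have -> : (point z - o) ord0 j =
      (x ord0 j - o ord0 j) - (x ord0 j - point z ord0 j) by rewrite !mxE; ring.
  apply: le_trans (ler_normB _ _) _; rewrite lerD2l.
  exact: le_trans (coord_le_edist _ _ _) zr.
have zN l : `|z ord0 l| <= N%:Z.
  rewrite -(ler_int R); apply: le_trans (zM l) _.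
  apply: le_trans (ler_norm _) _; apply/ltW.
  apply: (@le_lt_trans _ _ (\sum_l `|M l|)).
    by rewrite (bigD1 l)//= lerDl; apply: sumr_ge0.
  by apply: archi_boundP; apply: sumr_ge0.
(* The index of an integer a of [-N, N] in 'I_(N + N).+1 is a + N. *)
exists (\row_l inord `|(z ord0 l + N%:Z)%R|%N) => //=; congr point.
apply/rowP => l; rewrite !mxE; move: (zN l); rewrite ler_norml => /andP[zl zu].
rewrite inordK; last by rewrite ltnS; lia.
by rewrite gez0_abs ?addrK//; lia.
Qed.

Lemma lattice_affine a b c : range point a -> range point b -> range point c ->
  range point (a - b + c).
Proof.
move=> [za _ <-] [zb _ <-] [zc _ <-]; exists (za - zb + zc) => //.
rewrite /point map_mxD map_mxB mulmxDl mulmxBl.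
move: (map_mx _ za *m V) (map_mx _ zb *m V) (map_mx _ zc *m V) => A B C.
by apply/rowP => j; rewrite !mxE; ring.
Qed.

End lattices.

Theorem lemma1 (R : realType) (n : nat) (B : set 'rV[R]_n)
    (hn : (0 < n)%N) (hB : regular_lattice B) :
  forall i, B i -> forall k : nat, (1 <= k)%N ->
    kth_area B k i = kth_area B k.+1 i.
Proof.
case: hB => o [V [Vunit ->]] i Bi k _; apply: kth_area_const => //.
- exact: lattice_infinite.
- by move=> x; exact: lattice_locally_finite.
- exact: lattice_affine.
Qed.
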